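(* Let $(\tau_{\alpha\beta}(\mathbf s,\mathbf t,\bar{\mathbf t}))_{\alpha,\beta=1,\dots,N}$ be a tau-function of the $N$-component Toda lattice hierarchy (as defined in the context). Then for all $\alpha,\beta\in\{1,\dots,N\}$ and all $\mathbf s,\mathbf t,\bar{\mathbf t},\mathbf s',\mathbf t',\bar{\mathbf t}'$ $$\sum_{\gamma=1}^N(-1)^{\delta_{\beta\gamma}}\oint_{C_\infty}z^{s_\gamma-s'_\gamma+\delta_{\alpha\gamma}+\delta_{\beta\gamma}-2}e^{\xi(\mathbf t_\gamma-\mathbf t'_\gamma,z)}\,\tau_{\alpha\gamma}(\mathbf s,\mathbf t-[z^{-1}]_\gamma,\bar{\mathbf t})\,\tau_{\gamma\beta}(\mathbf s',\mathbf t'+[z^{-1}]_\gamma,\bar{\mathbf t}')\,dz$$ $$=\sum_{\gamma=1}^N(-1)^{\delta_{\alpha\gamma}}\oint_{C_\infty}z^{s'_\gamma-s_\gamma-2}e^{\xi(\bar{\mathbf t}_\gamma-\bar{\mathbf t}'_\gamma,z)}\,\tau_{\alpha\gamma}(\mathbf s+[1]_\gamma,\mathbf t,\bar{\mathbf t}-[z^{-1}]_\gamma)\,\tau_{\gamma\beta}(\mathbf s'-[1]_\gamma,\mathbf t',\bar{\mathbf t}'+[z^{-1}]_\gamma)\,dz.$$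
   Context: Fix $N\ge1$. Variables: $\mathbf s=(s_1,\dots,s_N)\in\mathbb Z^N$, $\mathbf t=(t_{\alpha,k})$ and $\bar{\mathbf t}=(\bar t_{\alpha,k})$ with $1\le\alpha\le N$, $k\ge1$; $\mathbf t_\alpha=(t_{\alpha,k})_{k\ge1}$, $\bar{\mathbf t}_\alpha=(\bar t_{\alpha,k})_{k\ge1}$. $\xi(\mathbf t_\alpha,z)=\sum_{k\ge1}t_{\alpha,k}z^k$. $\mathbf t\pm[z^{-1}]_\gamma$ is $\mathbf t$ with $t_{\alpha,j}$ replaced by $t_{\alpha,j}\pm\delta_{\alpha\gamma}z^{-j}/j$ (same for $\bar{\mathbf t}$). $\mathbf s\pm[1]_\alpha$ is $\mathbf s$ with $s_\alpha$ replaced by $s_\alpha\pm1$. Functions of the times are treated as formal power series. $C_\infty$ is a big circle around $\infty$; $\oint_{C_\infty}$ means $2\pi i$ times the coefficient of $z^{-1}$ of the formal series in the integrand. **Wave functions.** Wave functions and adjoint wave functions of the $N$-component Toda lattice hierarchy are characterized as families of the form $\Psi_{\alpha\beta}(\mathbf s,\mathbf t,\bar{\mathbf t};z)=z^{s_\beta}e^{\xi(\mathbf t_\beta,z)}\sum_{j\ge0}w_{j,\alpha\beta}z^{-j}$, $\Psi^*_{\alpha\beta}=z^{-s_\alpha}e^{-\xi(\mathbf t_\alpha,z)}\sum_{j\ge0}w^*_{j,\alpha\beta}z^{-j}$, $\bar\Psi_{\alpha\beta}=z^{s_\beta}e^{\xi(\bar{\mathbf t}_\beta,z^{-1})}\sum_{j\ge0}\bar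 w_{j,\alpha\beta}z^{j}$, $\bar\Psi^*_{\alpha\beta}=z^{-s_\alpha}e^{-\xi(\bar{\mathbf t}_\alpha,z^{-1})}\sum_{j\ge0}\bar w^*_{j,\alpha\beta}z^{j}$ with coefficients depending on $(\mathbf s,\mathbf t,\bar{\mathbf t})$, $w_{0}=w_0^*=1_N$, $\bar w_0,\bar w^*_0$ invertible, which satisfy for all $\alpha,\beta$ and all values of the variables $$\sum_{\gamma}\oint_{C_\infty}\Psi_{\alpha\gamma}(\mathbf s,\mathbf t,\bar{\mathbf t};z)\Psi^*_{\gamma\beta}(\mathbf s',\mathbf t',\bar{\mathbf t}';z)dz=\sum_{\gamma}\oint_{C_\infty}\bar\Psi_{\alpha\gamma}(\mathbf s,\mathbf t,\bar{\mathbf t};z^{-1})\bar\Psi^*_{\gamma\beta}(\mathbf s',\mathbf t',\bar{\mathbf t}';z^{-1})z^{-2}dz.$$ **Tau-function.** A tau-function is an $N\times N$ matrix function $(\tau_{\alpha\beta}(\mathbf s,\mathbf t,\bar{\mathbf t}))$ with all diagonal elements equal to one function $\tau$, through which such wave functions are expressed by $\Psi_{\alpha\beta}(z)=z^{s_\beta+\delta_{\alpha\beta}-1}e^{\xi(\mathbf t_\beta,z)}\tau_{\alpha\beta}(\mathbf s,\mathbf t-[z^{-1}]_\beta,\bar{\mathbf t})/\tau(\mathbf s,\mathbf t,\bar{\mathbf t})$, $\Psi^*_{\alpha\beta}(z)=(-1)^{\delta_{\alpha\beta}-1}z^{-s_\alpha+\delta_{\alpha\beta}-1}e^{-\xi(\mathbf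 t_\alpha,z)}\tau_{\alpha\beta}(\mathbf s,\mathbf t+[z^{-1}]_\alpha,\bar{\mathbf t})/\tau(\mathbf s,\mathbf t,\bar{\mathbf t})$, $\bar\Psi_{\alpha\beta}(z^{-1})=(-1)^{\delta_{\alpha\beta}-1}z^{-s_\beta}e^{\xi(\bar{\mathbf t}_\beta,z)}\tau_{\alpha\beta}(\mathbf s+[1]_\beta,\mathbf t,\bar{\mathbf t}-[z^{-1}]_\beta)/\tau(\mathbf s,\mathbf t,\bar{\mathbf t})$, $\bar\Psi^*_{\alpha\beta}(z^{-1})=z^{s_\alpha}e^{-\xi(\bar{\mathbf t}_\alpha,z)}\tau_{\alpha\beta}(\mathbf s-[1]_\alpha,\mathbf t,\bar{\mathbf t}+[z^{-1}]_\alpha)/\tau(\mathbf s,\mathbf t,\bar{\mathbf t})$. *)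

(* Defs.v *)
From HB Require Import structures.
From mathcomp Require Import all_boot all_order all_algebra.
From mathcomp Require Import finmap multiset complex.
From mathcomp Require Import mathcomp_extra boolp classical_sets functions.
From mathcomp Require Import cardinality fsbigop reals trigo.
From mathcomp Require Import zify.

Set Implicit Arguments.
Unset Strict Implicit.
Unset Printing Implicit Defensive.

Import Order.TTheory GRing.Theory Num.Theory.

Local Open Scope classical_set_scope.
Local Open Scope ring_scope.

(* A monomial in the variables [V], given by its exponents, written additively. *)
Definition monom (V : choiceType) := multiset V.

HB.instance Definition _ (V : choiceType) := Choice.on (monom V).
HB.instance Definition _ (V : choiceType) :=
  GRing.isNmodule.Build (monom V)
    (@msetDA V) (@msetDC V) (@mset0D V).

Section Convolution.
Context {M : nmodType} {R : comNzRingType}.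
Implicit Types (f g h : M -> R) (m : M) (A B C : seq M).

(* [\sum_(i \in P)] ranges over the support of its summand, and is 0 by
   convention when that support is infinite, which never happens below. *)
Definition conv f g m : R :=
  \sum_(p \in [set p : M * M | p.1 + p.2 = m]) f p.1 * g p.2.

Definition conv1 m : R := (m == 0)%:R.

Definition covers2 f g m A B :=
  [/\ uniq A, uniq B & forall a b, a + b = m -> f a != 0 -> g b != 0 ->
      (a \in A) && (b \in B)].

Lemma convE f g m A B : covers2 f g m A B ->
  conv f g m = \sum_(a <- A) \sum_(b <- B | a + b == m) f a * g b.
Proof.
move=> [uA uB cov]; rewrite /conv.
have u : uniq [seq (a, b) | a <- A, b <- B] by apply: allpairs_uniq => // -[a b] [c d] _ _ /= [-> ->].
have -> : [set p : M * M | p.1 + p.2 = m] = [set` [pred p : M * M | p.1 + p.2 == m]].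
  by apply/seteqP; split => p /=; rewrite inE => /eqP.
rewrite -(@bigfs _ _ _ _ [seq (a, b) | a <- A, b <- B]) //.
  rewrite big_mkcond big_allpairs_dep; apply: eq_bigr => a _.
  by rewrite -big_mkcond.
move=> [a b] /= /eqP abm; apply: contraNeq => fg0.
have f0 : f a != 0 by apply: contraNneq fg0 => ->; rewrite mul0r.
have g0 : g b != 0 by apply: contraNneq fg0 => ->; rewrite mulr0.
by have /andP[aA bB] := cov _ _ abm f0 g0; apply/allpairsP; exists (a, b).
Qed.

Lemma conv_neq0 f g m : conv f g m != 0 ->
  exists a b, [/\ a + b = m, f a != 0 & g b != 0].
Proof.
apply: contra_neqP => H; rewrite /conv fsbig1 // => -[a b] /= abm.
have [->|f0] := eqVneq (f a) 0; first by rewrite mul0r.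
have [->|g0] := eqVneq (g b) 0; first by rewrite mulr0.
by case: H; exists a, b.
Qed.

Lemma convC f g : conv f g = conv g f.
Proof.
apply/funext => m; rewrite /conv.
rewrite (reindex_fsbig (fun p : M * M => (p.2, p.1))
  [set p : M * M | p.1 + p.2 = m] [set p : M * M | p.1 + p.2 = m]) /=.
  by apply: eq_fsbigr => p _; rewrite mulrC.
split=> [p /= <-|[a b] [c d] _ _ [-> ->]//|[a b] /= <-]; first by rewrite addrC.
by exists (b, a) => //=; rewrite addrC.
Qed.

Lemma conv1l f : conv conv1 f = f.
Proof.
apply/funext => m; rewrite (@convE _ _ _ [:: 0] [:: m]).
  by rewrite !big_cons !big_nil add0r eqxx /conv1 eqxx mul1r !addr0.
split=> // a b; rewrite /conv1 !inE; have [->|] := eqVneq a 0.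
  by rewrite add0r => ->; rewrite eqxx.
by rewrite eqxx.
Qed.

Lemma convDl f f' g m A B : covers2 f g m A B -> covers2 f' g m A B ->
  conv (fun a => f a + f' a) g m = conv f g m + conv f' g m.
Proof.
move=> cf cf'; rewrite (convE cf) (convE cf') (@convE _ _ _ A B).
  rewrite -big_split /=; apply: eq_bigr => a _.
  by rewrite -big_split /=; apply: eq_bigr => b _; rewrite mulrDl.
case: cf cf' => uA uB cf [_ _ cf']; split=> // a b abm.
have [->|f0] := eqVneq (f a) 0; first by rewrite add0r => *; apply: cf'.
by move=> _ *; apply: cf.
Qed.

Lemma convA f g h m A B C : uniq A -> uniq B -> uniq C ->
  (forall a b c, a + b + c = m -> f a != 0 -> g b != 0 -> h c != 0 ->
     [&& a \in A, b \in B & c \in C]) ->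
  conv f (conv g h) m = conv (conv f g) h m.
Proof.
move=> uA uB uC cov.
pose S := fun (A B : seq M) => undup [seq a + b | a <- A, b <- B].
have sumS (A' B' : seq M) (F : M -> M -> M -> R) (P : pred M) :
  \sum_(x <- S A' B' | P x) \sum_(a <- A') \sum_(b <- B' | a + b == x) F x a b =
  \sum_(a <- A') \sum_(b <- B' | P (a + b)) F (a + b) a b.
  rewrite exchange_big /= big_seq [RHS]big_seq; apply: eq_bigr => a aA.
  under eq_bigr do rewrite big_mkcond.
  rewrite exchange_big /= [RHS]big_mkcond big_seq [RHS]big_seq.
  apply: eq_bigr => b bB; rewrite -big_mkcondr /=.
  rewrite (eq_bigl (fun x => (x == a + b) && P (a + b))); last first.
    move=> x; rewrite eq_sym andbC.
    by have [->|] := eqVneq x (a + b).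
  have abS : a + b \in S A' B' by rewrite mem_undup; apply/allpairsP; exists (a, b).
  case: (P _); last by rewrite big1 // => x; rewrite andbF.
  under eq_bigl do rewrite andbT.
  by rewrite -big_filter (filter_pred1_uniq (undup_uniq _)) // big_seq1.
have covg x a : a + x = m -> f a != 0 -> covers2 g h x B C.
  move=> axm fa; split => // b c bcx gb hc.
  by have /and3P[_ -> ->] := cov a b c (etrans (esym (addrA _ _ _))
    (etrans (congr1 _ bcx) axm)) fa gb hc.
have covf x c : x + c = m -> h c != 0 -> covers2 f g x A B.
  move=> xcm hc; split => // a b abx fa gb.
  by have /and3P[-> -> _] := cov a b c (etrans (congr1 (+%R^~ c) abx) xcm) fa gb hc.
rewrite (@convE f _ m A (S B C)); last first.
  split; rewrite ?undup_uniq // => a x axm fa /conv_neq0[b [c [bcx gb hc]]].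
  have /and3P[aA bB cC] := cov a b c (etrans (esym (addrA _ _ _))
    (etrans (congr1 _ bcx) axm)) fa gb hc.
  by rewrite aA mem_undup; apply/allpairsP; exists (b, c).
rewrite (@convE _ h m (S A B) C); last first.
  split; rewrite ?undup_uniq // => x c xcm /conv_neq0[a [b [abx fa gb]]] hc.
  have /and3P[aA bB cC] := cov a b c (etrans (congr1 (+%R^~ c) abx) xcm) fa gb hc.
  by rewrite cC andbT mem_undup; apply/allpairsP; exists (a, b).
transitivity (\sum_(a <- A) \sum_(b <- B) \sum_(c <- C | a + b + c == m)
  f a * g b * h c).
  apply: eq_bigr => a _.
  transitivity (\sum_(x <- S B C | a + x == m) \sum_(b <- B)
     \sum_(c <- C | b + c == x) f a * g b * h c).
    apply: eq_bigr => x /eqP axm.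
    have [->|fa] := eqVneq (f a) 0.
      by rewrite mul0r big1 // => b _; rewrite big1 // => c _; rewrite !mul0r.
    rewrite (convE (covg _ _ axm fa)) mulr_sumr; apply: eq_bigr => b _.
    by rewrite mulr_sumr; apply: eq_bigr => c _; rewrite mulrA.
  rewrite (sumS _ _ (fun x b c => f a * g b * h c)).
  by apply: eq_bigr => b _; apply: eq_bigl => c; rewrite addrA.
symmetry; rewrite (exchange_big_dep xpredT) //=.
under [RHS]eq_bigr do under eq_bigr do rewrite big_mkcond.
under [RHS]eq_bigr do rewrite exchange_big.
rewrite [RHS]exchange_big /=; apply: eq_bigr => c _.
transitivity (\sum_(x <- S A B | x + c == m) \sum_(a <- A)
   \sum_(b <- B | a + b == x) f a * g b * h c).
  apply: eq_bigr => x /eqP xcm.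
  have [->|hc] := eqVneq (h c) 0.
    by rewrite mulr0 big1 // => b _; rewrite big1 // => ? _; rewrite !mulr0.
  rewrite (convE (covf _ _ xcm hc)) mulr_suml; apply: eq_bigr => a _.
  by rewrite mulr_suml; apply: eq_bigr.
rewrite (sumS _ _ (fun x a b => f a * g b * h c)).
by apply: eq_bigr => a _; rewrite [LHS]big_mkcond.
Qed.

End Convolution.

(* The inverse is noncomputable: a ring of series gets its unit structure by
   choosing an inverse whenever one exists. *)
Section ClassicalInverse.
Context {R : comNzRingType}.

Definition is_inv (x y : R) := y * x = 1.
Definition cunit : pred R := fun x => `[< exists y, is_inv x y >].
Definition cinv (x : R) : R :=
  if pselect (exists y, is_inv x y) is left e then projT1 (cid e) else x.

Lemma cmulVx : {in cunit, left_inverse 1 cinv *%R}.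
Proof.
move=> x /asboolP ex; rewrite /cinv; case: pselect => // e.
by case: cid.
Qed.

Lemma cunitPl x y : y * x = 1 -> cunit x.
Proof. by move=> yx; apply/asboolP; exists y. Qed.

Lemma cinv_out : {in [predC cunit], cinv =1 id}.
Proof.
move=> x; rewrite inE => nx; rewrite /cinv; case: pselect => // e.
by case/negP: nx; apply/asboolP.
Qed.
End ClassicalInverse.

(* Formal power series R[[V]] in a possibly infinite set V of variables. *)
Record fps (R : Type) (V : choiceType) := Fps { fcoef :> monom V -> R }.

HB.instance Definition _ R V := gen_eqMixin (fps R V).
HB.instance Definition _ R V := gen_choiceMixin (fps R V).

Section FpsRing.
Context {R : comNzRingType} {V : choiceType}.
Implicit Types f g h : fps R V.

Lemma fpsP f g : fcoef f =1 fcoef g -> f = g.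
Proof. by case: f g => f [g] /funext /= ->. Qed.

Definition fps0 : fps R V := Fps (fun=> 0).
Definition fpsN f : fps R V := Fps (fun m => - f m).
Definition fpsD f g : fps R V := Fps (fun m => f m + g m).
Definition fps1 : fps R V := Fps conv1.
Definition fpsM f g : fps R V := Fps (conv f g).

Let fpsDA : associative fpsD.
Proof. by move=> f g h; apply: fpsP => m; rewrite /= addrA. Qed.
Let fpsDC : commutative fpsD.
Proof. by move=> f g; apply: fpsP => m; rewrite /= addrC. Qed.
Let fps0D : left_id fps0 fpsD.
Proof. by move=> f; apply: fpsP => m; rewrite /= add0r. Qed.
Let fpsND : left_inverse fps0 fpsN fpsD.
Proof. by move=> f; apply: fpsP => m; rewrite /= addNr. Qed.

HB.instance Definition _ :=
  GRing.isZmodule.Build (fps R V) fpsDA fpsDC fps0D fpsND.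

Lemma monom_divisors (m : monom V) :
  exists2 s : seq (monom V), uniq s & forall a b : monom V, a + b = m -> a \in s.
Proof.
pose n := \max_(x <- finsupp m) m x.
pose s : seq (monom V) :=
  [seq [fsfun x : finsupp m => (g x : nat)] | g : {ffun finsupp m -> 'I_n.+1}].
exists (undup s) => [|a b abm]; first exact: undup_uniq.
have le_am x : (a x <= m x)%N by rewrite -abm msetE2 leq_addr.
have le_mn x : (m x <= n)%N.
  have [xm|/fsfun_dflt ->//] := boolP (x \in finsupp m).
  by rewrite /n (big_rem x xm) leq_maxl.
rewrite mem_undup; apply/mapP.
exists [ffun x : finsupp m => inord (a (val x))]; first by rewrite mem_enum.
apply/fsfunP => x; rewrite fsfun_ffun; case: insubP => /= [u _ <-|].
  by rewrite ffunE inordK // ltnS (leq_trans (le_am _)).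
by move=> /fsfun_dflt xm; apply/eqP; rewrite -leqn0 -[X in (_ <= X)%N]xm.
Qed.

Lemma fps_covers f g m : exists A B, covers2 f g m A B.
Proof.
have [s us ds] := monom_divisors m; exists s, s; split=> // a b abm _ _.
by rewrite (ds a b) // (ds b a) // addrC.
Qed.

Let fpsMA : associative fpsM.
Proof.
move=> f g h; apply: fpsP => m /=; have [s us ds] := monom_divisors m.
apply: (@convA _ _ f g h m s s s us us us) => a b c abcm _ _ _.
apply/and3P; split; [apply: (ds a (b + c))|apply: (ds b (a + c))|apply: (ds c (a + b))].
- by rewrite addrA.
- by rewrite addrCA addrA.
- by rewrite [LHS]addrC.
Qed.
Let fpsMC : commutative fpsM.
Proof. by move=> f g; apply: fpsP => m /=; rewrite convC. Qed.
Let fps1M : left_id fps1 fpsM.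
Proof. by move=> f; apply: fpsP => m /=; rewrite conv1l. Qed.
Let fpsMDl : left_distributive fpsM fpsD.
Proof.
move=> f g h; apply: fpsP => m /=; have [s us ds] := monom_divisors m.
apply: (@convDl _ _ f g h m s s); split=> // a b abm _ _;
  by rewrite (ds a b) // (ds b a) // addrC.
Qed.
Let fps1_neq0 : fps1 != 0.
Proof.
apply/eqP => /(congr1 (fun f => fcoef f 0)) /=.
by rewrite /conv1 eqxx => /eqP; rewrite oner_eq0.
Qed.

HB.instance Definition _ := GRing.Zmodule_isComNzRing.Build (fps R V)
  fpsMA fpsMC fps1M fpsMDl fps1_neq0.
HB.instance Definition _ := GRing.ComNzRing_hasMulInverse.Build (fps R V)
  cmulVx cunitPl cinv_out.

Definition fpsC (c : R) : fps R V := Fps (fun m => if m == 0 then c else 0).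
Definition fpsX (v : V) : fps R V :=
  Fps (fun m => if m == [mset v]%mset :> monom V then 1 else 0).

End FpsRing.

(* Formal Laurent series F((z^-1)): finitely many positive powers of z. *)
Record laurent (F : nmodType) := Laurent {
  lcoef :> int -> F;
  _ : exists n : int, forall k, n < k -> lcoef k = 0 }.

HB.instance Definition _ F := gen_eqMixin (laurent F).
HB.instance Definition _ F := gen_choiceMixin (laurent F).

Section LaurentRing.
Context {F : comNzRingType}.
Implicit Types f g h : laurent F.

Lemma laurent_bound f : exists n : int, forall k, n < k -> f k = 0.
Proof. by case: f. Qed.

Lemma laurentP f g : lcoef f =1 lcoef g -> f = g.
Proof.
case: f g => f fP [g gP] /funext /= E; case: _ / E in gP *.
by congr Laurent; exact: Prop_irrelevance.
Qed.

Lemma laurent0_subproof : exists n : int, forall k, n < k -> (fun=> 0 : F) k = 0.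
Proof. by exists 0. Qed.
Lemma laurentN_subproof f : exists n : int, forall k, n < k -> - f k = 0.
Proof. by have [n fn] := laurent_bound f; exists n => k /fn ->; rewrite oppr0. Qed.
Lemma laurentD_subproof f g : exists n : int, forall k, n < k -> f k + g k = 0.
Proof.
have [n fn] := laurent_bound f; have [p gp] := laurent_bound g.
exists (Num.max n p) => k; rewrite gt_max => /andP[/fn -> /gp ->].
by rewrite addr0.
Qed.
Lemma laurentM_subproof f g : exists n : int, forall k, n < k -> conv f g k = 0.
Proof.
have [n fn] := laurent_bound f; have [p gp] := laurent_bound g.
exists (n + p) => k npk; apply/eqP; apply: contraTT npk => /conv_neq0[a [b [<-]]].
move=> fa gb; rewrite -leNgt lerD // leNgt.
  by apply: contra_neqN fa => /fn.
by apply: contra_neqN gb => /gp.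
Qed.
Lemma zpow_subproof (n : int) :
  exists p : int, forall k, p < k -> (k == n)%:R = 0 :> F.
Proof. by exists n => k; rewrite lt_neqAle eq_sym => /andP[/negPf ->]. Qed.
Lemma zser_subproof (a : nat -> F) : exists n : int, forall k, n < k ->
  (if k <= 0 then a `|k|%N else 0) = 0.
Proof. by exists 0 => k; rewrite ltNge => /negPf ->. Qed.

Definition laurent0 := Laurent laurent0_subproof.
Definition laurentN f := Laurent (laurentN_subproof f).
Definition laurentD f g := Laurent (laurentD_subproof f g).
Definition laurentM f g := Laurent (laurentM_subproof f g).

(* z^n *)
Definition zpow n := Laurent (zpow_subproof n).
(* \sum_(j >= 0) a_j z^-j *)
Definition zser a := Laurent (zser_subproof a).

Let laurentDA : associative laurentD.
Proof. by move=> f g h; apply: laurentP => m; rewrite /= addrA. Qed.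
Let laurentDC : commutative laurentD.
Proof. by move=> f g; apply: laurentP => m; rewrite /= addrC. Qed.
Let laurent0D : left_id laurent0 laurentD.
Proof. by move=> f; apply: laurentP => m; rewrite /= add0r. Qed.
Let laurentND : left_inverse laurent0 laurentN laurentD.
Proof. by move=> f; apply: laurentP => m; rewrite /= addNr. Qed.

HB.instance Definition _ := GRing.isZmodule.Build (laurent F)
  laurentDA laurentDC laurent0D laurentND.

Lemma int_segment (lo hi : int) :
  exists2 s : seq int, uniq s & forall k, lo <= k -> k <= hi -> k \in s.
Proof.
exists [seq lo + i%:Z | i <- iota 0 (`|hi - lo|%N).+1].
  by rewrite map_inj_uniq ?iota_uniq // => i j /addrI [].
move=> k lok khi; apply/mapP; exists `|k - lo|%N.
  rewrite mem_iota add0n /= ltnS -lez_nat !gez0_abs ?subr_ge0 ?lerB //.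
  exact: le_trans lok khi.
by rewrite gez0_abs ?subr_ge0 // [RHS]addrC subrK.
Qed.

Lemma laurent_le f : exists n : int, forall k, f k != 0 -> k <= n.
Proof.
have [n fn] := laurent_bound f; exists n => k; rewrite leNgt.
by apply: contra_neqN => /fn.
Qed.

Lemma laurent_covers3 f g h m : exists s, uniq s /\
  (forall a b c, a + b + c = m -> f a != 0 -> g b != 0 -> h c != 0 ->
     [&& a \in s, b \in s & c \in s]).
Proof.
have [n fn] := laurent_le f; have [p gp] := laurent_le g.
have [q hq] := laurent_le h.
pose hi : int := `|n| + `|p| + `|q|.
have [s us ds] := int_segment (m - hi - hi) hi.
exists s; split=> // a b c abcm /fn an /gp bp /hq cq.
have [n0 p0 q0] : [/\ n <= `|n|, p <= `|p| & q <= `|q|] by split; exact: ler_norm.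
have [n1 p1 q1] : [/\ 0 <= `|n|, 0 <= `|p| & 0 <= `|q|] by split; exact: normr_ge0.
by apply/and3P; split; apply: ds; rewrite /hi; lia.
Qed.

Let laurentMA : associative laurentM.
Proof.
move=> f g h; apply: laurentP => m /=; have [s [us ds]] := laurent_covers3 f g h m.
exact: (@convA _ _ f g h m s s s us us us).
Qed.
Let laurentMC : commutative laurentM.
Proof. by move=> f g; apply: laurentP => m /=; rewrite convC. Qed.
Let laurent1M : left_id (zpow 0) laurentM.
Proof. by move=> f; apply: laurentP => m /=; rewrite conv1l. Qed.
Let laurentMDl : left_distributive laurentM laurentD.
Proof.
have cov2 f g m : exists2 s, uniq s & forall a b, a + b = m -> f a != 0 -> g b != 0 ->
    (a \in s) && (b \in s).
  have [s [us ds]] := laurent_covers3 f g (zpow 0) m; exists s => // a b abm fa gb.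
  have z0 : lcoef (zpow 0 : laurent F) 0 != 0 by exact: oner_neq0.
  by have /and3P[-> ->] := ds a b 0 (etrans (addr0 _) abm) fa gb z0.
move=> f f' g; apply: laurentP => m /=.
have [s us ds] := cov2 f g m; have [s' us' ds'] := cov2 f' g m.
apply: (@convDl _ _ f f' g m (undup (s ++ s')) (undup (s ++ s'))).
  split; rewrite ?undup_uniq // => a b abm fa gb.
  by have /andP[aA bB] := ds _ _ abm fa gb; rewrite !mem_undup !mem_cat aA bB.
split; rewrite ?undup_uniq // => a b abm fa gb.
by have /andP[aA bB] := ds' _ _ abm fa gb; rewrite !mem_undup !mem_cat aA bB !orbT.
Qed.
Let laurent1_neq0 : zpow 0 != 0.
Proof.
by apply/eqP => /(congr1 (fun f => lcoef f 0)) /eqP; rewrite oner_eq0.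
Qed.

HB.instance Definition _ := GRing.Zmodule_isComNzRing.Build (laurent F)
  laurentMA laurentMC laurent1M laurentMDl laurent1_neq0.
HB.instance Definition _ := GRing.ComNzRing_hasMulInverse.Build (laurent F)
  cmulVx cunitPl cinv_out.

End LaurentRing.

Section Operations.
Context {V : choiceType}.

(* The substitution of the variable [i v] for each variable [v], for an
   injective [i]: several monomials are summed only if [i] is not injective. *)
Definition fps_rename {R : comNzRingType} {W : choiceType} (i : V -> W)
    (f : fps R V) : fps R W :=
  Fps (fun m => \sum_(m' \in [set m' : monom V |
                        seq_mset [seq i v | v <- enum_mset m'] = m]) f m').

(* Meant for [f] without constant term: then [(f ^+ n) m] vanishes for large n. *)
Definition fps_exp {R : comUnitRingType} (f : fps R V) : fps R V :=
  Fps (fun m => \sum_(n \in [set: nat]) (f ^+ n) m / n`!%:R).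

Context {F : comUnitRingType}.

(* \sum_(j >= 0) w_j z^-j *)
Definition fps_zser (w : nat -> fps F V) : fps (laurent F) V :=
  Fps (fun m => zser (fun j => w j m)).

(* The inclusion of the series that do not depend on z. *)
Definition fps_zconst (f : fps F V) : fps (laurent F) V :=
  fps_zser (fun j => if j == 0%N then f else 0).

Definition fps_zpow (n : int) : fps (laurent F) V := fpsC (zpow n).

(* \sum_(k >= 1) x_k z^k; the indexing of [x] starts at 0, so that [x k] is
   x_(k+1). *)
Definition xi (x : nat -> fps (laurent F) V) : fps (laurent F) V :=
  Fps (fun m => \sum_(k \in [set: nat]) (fps_zpow k.+1%:Z * x k) m).

(* The substitution of [x v] for each variable [v], where no positive power of z
   occurs in [x v]; the coefficient of z^-n in front of each monomial of the
   result is computed as a sum over the monomials of [f]. *)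
Definition fps_subst (x : V -> fps (laurent F) V) (f : fps F V) :
    fps (laurent F) V :=
  Fps (fun m => zser (fun n => \sum_(m' \in [set: monom V])
    f m' * (\prod_(v <- finsupp m') x v ^+ m' v) m (- n%:Z))).

End Operations.

(* [oint f] is 2 pi i times the coefficient of z^-1 in [f]. *)
Definition oint {R : realType} {V : choiceType} (f : fps (laurent R[i]) V) :
    fps R[i] V :=
  Fps (fun m => (2 * pi)%:C%C * 'i%C * f m (-1)).

Section Toda.
Context {R : realType} {N : nat}.

(* [(false, a, k)] is the variable t_(a, k+1) and [(true, a, k)] the variable
   \bar t_(a, k+1), so that the second index runs over k+1 >= 1. *)
Definition times : choiceType := (bool * 'I_N * nat)%type.

Definition series := fps R[i] times.
(* C((z^-1))[[t, \bar t]] *)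
Definition zseries := fps (laurent R[i]) times.
(* C((z^-1))[[t, \bar t, t', \bar t']], with [inl v] the unprimed and [inr v]
   the primed copy of the time [v] *)
Definition zseries2 := fps (laurent R[i]) (times + times)%type.

Definition unprimed (f : zseries) : zseries2 := fps_rename inl f.
Definition primed (f : zseries) : zseries2 := fps_rename inr f.

Definition tvar (a : 'I_N) (k : nat) : zseries := fpsX ((false, a, k) : times).
Definition tbvar (a : 'I_N) (k : nat) : zseries := fpsX ((true, a, k) : times).

(* [tshift b c e f] is f(t + e [z^-1]_c, \bar t) for [b = false] and
   f(t, \bar t + e [z^-1]_c) for [b = true]. *)
Definition tshift (b : bool) (c : 'I_N) (e : int) (f : series) : zseries :=
  fps_subst (fun v : times => let: (b', a, k) := v in
    fpsX v +
    if (b' == b) && (a == c) then fpsC (zpow (- k.+1%:Z) / k.+1%:R *~ e)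
    else 0) f.

Definition kdelta (a b : 'I_N) : int := (a == b)%:Z.

Definition lattice := 'rV[int]_N.
Definition unitv (a : 'I_N) : lattice := delta_mx 0 a.

Definition family := lattice -> 'I_N -> 'I_N -> zseries.
Definition coeffs := lattice -> nat -> 'M[series]_N.

(* The barred wave functions, which are series in z with finitely many negative
   powers, are represented by their values at z^-1: [Psib] stands for
   \bar Psi(s, t, \bar t; z^-1) and [Psibs] for \bar Psi^*(s, t, \bar t; z^-1). *)
Record wave_functions (Psi Psis Psib Psibs : family) : Prop := WaveFunctions {
  wave_form : exists w : coeffs, (forall s, w s 0 = 1%:M) /\
    forall s a b, Psi s a b =
      fps_zpow (s 0 b) * fps_exp (xi (tvar b)) * fps_zser (fun j => w s j a b);
  wave_adj_form : exists ws : coeffs, (forall s, ws s 0 = 1%:M) /\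
    forall s a b, Psis s a b =
      fps_zpow (- s 0 a) * fps_exp (- xi (tvar a)) *
      fps_zser (fun j => ws s j a b);
  wave_bar_form : exists wb : coeffs, (forall s, wb s 0 \in unitmx) /\
    forall s a b, Psib s a b =
      fps_zpow (- s 0 b) * fps_exp (xi (tbvar b)) *
      fps_zser (fun j => wb s j a b);
  wave_bar_adj_form : exists wbs : coeffs, (forall s, wbs s 0 \in unitmx) /\
    forall s a b, Psibs s a b =
      fps_zpow (s 0 a) * fps_exp (- xi (tbvar a)) *
      fps_zser (fun j => wbs s j a b);
  wave_bilinear : forall (s s' : lattice) (a b : 'I_N),
    \sum_(c < N) oint (unprimed (Psi s a c) * primed (Psis s' c b)) =
    \sum_(c < N) oint (unprimed (Psib s a c) * primed (Psibs s' c b)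
                       * fps_zpow (- 2)) }.

Definition tau_family := 'I_N -> 'I_N -> lattice -> series.

Section WaveOfTau.
Context (tau : tau_family) (tau0 : lattice -> series).

Definition tau_Psi : family := fun s a b =>
  fps_zpow (s 0 b + kdelta a b - 1) * fps_exp (xi (tvar b))
  * tshift false b (-1) (tau a b s) / fps_zconst (tau0 s).

Definition tau_Psis : family := fun s a b =>
  (-1) ^ (kdelta a b - 1) * fps_zpow (- s 0 a + kdelta a b - 1)
  * fps_exp (- xi (tvar a))
  * tshift false a 1 (tau a b s) / fps_zconst (tau0 s).

Definition tau_Psib : family := fun s a b =>
  (-1) ^ (kdelta a b - 1) * fps_zpow (- s 0 b) * fps_exp (xi (tbvar b))
  * tshift true b (-1) (tau a b (s + unitv b)) / fps_zconst (tau0 s).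

Definition tau_Psibs : family := fun s a b =>
  fps_zpow (s 0 a) * fps_exp (- xi (tbvar a))
  * tshift true a 1 (tau a b (s - unitv a)) / fps_zconst (tau0 s).

End WaveOfTau.

(* The common diagonal entry has to be invertible for the quotients above to be
   power series. *)
Definition tau_function (tau : tau_family) : Prop :=
  exists tau0 : lattice -> series,
    [/\ forall a s, tau a a s = tau0 s,
        forall s, tau0 s \is a GRing.unit &
        wave_functions (tau_Psi tau tau0) (tau_Psis tau tau0)
                       (tau_Psib tau tau0) (tau_Psibs tau tau0)].

(* t_a - t'_a and \bar t_a - \bar t'_a *)
Definition tdiff (a : 'I_N) (k : nat) : zseries2 :=
  unprimed (tvar a k) - primed (tvar a k).
Definition tbdiff (a : 'I_N) (k : nat) : zseries2 :=
  unprimed (tbvar a k) - primed (tbvar a k).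

End Toda.

Arguments tau_family : clear implicits.
Arguments lattice : clear implicits.
Arguments times : clear implicits.

(* Main.v *)
(* The bilinear identity of the wave functions becomes the one for [tau] once the
   common denominator [tau0 (s, t) * tau0 (s', t')], which does not depend on z
   and so commutes with the residue, is cleared; the two signs [(-1) ^ (d - 1)]
   each give [- (-1) ^ d], and the overall [-1] cancels. The exponentials combine
   because doubling the variables is a ring morphism and
   [exp (f + g) = exp f * exp g] for series without constant term. *)

Require Import Defs.
From mathcomp Require Import all_boot all_order all_algebra.
From mathcomp Require Import complex reals.
From mathcomp Require Import finmap multiset.
From mathcomp Require Import boolp classical_sets fsbigop.
From mathcomp Require trigo.
From mathcomp Require Import ring zify.

Set Implicit Arguments.
Unset Strict Implicit.
Unset Printing Implicit Defensive.

Import GRing.Theory Num.Theory.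

Local Open Scope ring_scope.

(** * Coefficients of sums, products and constant multiples of power series *)

Section Coefficient.
Context {R : comNzRingType} {V : choiceType}.
Implicit Types (f g : fps R V) (m : monom V).

Lemma fps_addE f g m : (f + g) m = f m + g m. Proof. by []. Qed.

Lemma fps_oppE f m : (- f) m = - f m. Proof. by []. Qed.

Lemma fps_mulE f g m : (f * g) m = conv f g m. Proof. by []. Qed.

Lemma fps_sumE (I : Type) (r : seq I) (P : pred I) (f : I -> fps R V) m :
  (\sum_(j <- r | P j) f j) m = \sum_(j <- r | P j) f j m.
Proof. by apply: (big_morph (fun f : fps R V => f m)). Qed.

(** One list of divisors serves both factors because addition of monomials is commutative. *)
Lemma fps_mul_divisors (r : seq (monom V)) f g m : uniq r ->
  (forall a b, a + b = m -> a \in r) ->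
  (f * g) m = \sum_(a <- r) \sum_(b <- r | a + b == m) f a * g b.
Proof.
move=> ur dr; apply: convE; split=> // a b abm _ _.
by rewrite (dr a b) // (dr b a) // addrC.
Qed.

Lemma fpsCM (c : R) f m : (fpsC c * f) m = c * f m.
Proof.
rewrite fps_mulE (@convE _ _ _ _ _ [:: 0] [:: m]).
  by rewrite !big_cons !big_nil add0r eqxx !addr0 /=; case: eqP.
split=> // a b abm /=; case: (a =P 0) => [a0|_]; last by rewrite eqxx.
by rewrite -abm a0 add0r !inE !eqxx.
Qed.

Lemma fpsC1 : fpsC 1 = 1 :> fps R V.
Proof. by apply: fpsP => m /=; rewrite /conv1; case: (m == 0). Qed.

Lemma fpsC_mul (c d : R) : fpsC (c * d) = fpsC c * fpsC d :> fps R V.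
Proof.
by apply: fpsP => m; rewrite fpsCM /=; case: (m == 0); rewrite ?mulr0.
Qed.

Lemma fpsCMn (c : R) n : fpsC (c *+ n) = fpsC c *+ n :> fps R V.
Proof.
apply: fpsP => m; elim: n => [|n IHn]; first by rewrite !mulr0n /=; case: (m == 0).
by rewrite !mulrS fps_addE -IHn /=; case: (m == 0); rewrite ?addr0.
Qed.

(** Only coefficients at divisors of [m] enter, so factors may be replaced by truncations that agree
    with them there. *)
Lemma eq_conv f f' g g' m :
  (forall a b, a + b = m -> f a = f' a /\ g b = g' b) ->
  (f * g) m = (f' * g') m.
Proof.
move=> E; apply: eq_fsbigr => -[a b]; rewrite inE /= => abm.
by have [-> ->] := E _ _ abm.
Qed.

End Coefficient.

(** * Laurent series constant in [z], and powers of [z] *)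

Section LaurentConstant.
Context {F : comUnitRingType}.

Lemma laurent_addE (f g : laurent F) k : (f + g) k = f k + g k.
Proof. by []. Qed.

Lemma laurent_sumE (I : Type) (r : seq I) (P : pred I) (f : I -> laurent F) k :
  (\sum_(j <- r | P j) f j) k = \sum_(j <- r | P j) f j k.
Proof. by apply: (big_morph (fun f : laurent F => f k)). Qed.

(** Written through [zser] to match the coefficients of [fps_zconst]. *)
Definition laurentC (c : F) : laurent F :=
  zser (fun j => if j == 0%N then c else 0).

Lemma laurentCE c k : laurentC c k = if k == 0 then c else 0.
Proof.
rewrite /=; case: ifP => k0; first by rewrite absz_eq0.
by case: eqP k0 => // ->.
Qed.

Lemma laurentCM c (h : laurent F) k : (laurentC c * h) k = c * h k.
Proof.
rewrite [LHS](@convE _ _ _ _ _ [:: 0] [:: k]).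
  by rewrite !big_cons !big_nil add0r eqxx !addr0 laurentCE.
split=> // a b abk; rewrite laurentCE; case: (a =P 0) => [a0|_].
  by rewrite -abk a0 add0r !inE !eqxx.
by rewrite eqxx.
Qed.

Lemma laurentC0 : laurentC 0 = 0.
Proof. by apply: laurentP => k; rewrite laurentCE; case: ifP. Qed.

Lemma laurentC1 : laurentC 1 = 1.
Proof. by apply: laurentP => k; rewrite laurentCE /=; case: (k == 0). Qed.

Lemma laurentC_mul c d : laurentC (c * d) = laurentC c * laurentC d.
Proof.
by apply: laurentP => k; rewrite laurentCM !laurentCE; case: ifP; rewrite ?mulr0.
Qed.

Lemma laurentC_add c d : laurentC (c + d) = laurentC c + laurentC d.
Proof.
apply: laurentP => k; rewrite laurent_addE !laurentCE.
by case: ifP; rewrite ?addr0.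
Qed.

Lemma laurentC_sum (I : Type) (r : seq I) (P : pred I) (c : I -> F) :
  laurentC (\sum_(j <- r | P j) c j) = \sum_(j <- r | P j) laurentC (c j).
Proof. exact: (big_morph _ laurentC_add laurentC0). Qed.

Lemma laurentC_unit c : c \is a GRing.unit -> laurentC c \is a GRing.unit.
Proof.
move=> cu; apply/unitrP; exists (laurentC c^-1).
by rewrite -!laurentC_mul mulVr // mulrV // laurentC1.
Qed.

Lemma laurentC_nat n : laurentC n%:R = n%:R.
Proof.
by elim: n => [|n IHn]; rewrite ?laurentC0 // !mulrS laurentC_add IHn laurentC1.
Qed.

Lemma zpowD m n : zpow (m + n) = zpow m * zpow n :> laurent F.
Proof.
apply: laurentP => k; rewrite [RHS](@convE _ _ _ _ _ [:: m] [:: n]).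
  rewrite !big_cons !big_nil /= !eqxx mulr1 !addr0 eq_sym.
  by case: eqP.
split=> // a b _ /=; rewrite !inE.
by case: (a == m); case: (b == n); rewrite /= ?eqxx.
Qed.

Section Zconst.
Context {V : choiceType}.
Implicit Types f g : fps F V.

Lemma fps_zconstE f m : fps_zconst f m = laurentC (f m).
Proof. by apply: laurentP => k /=; case: ifP => // _; case: `|k|%N. Qed.

Lemma fps_zconst1 : fps_zconst (1 : fps F V) = 1.
Proof.
apply: fpsP => m; rewrite fps_zconstE /= /conv1.
by case: (m == 0); rewrite ?laurentC1 ?laurentC0.
Qed.

Lemma fps_zconstM f g : fps_zconst (f * g) = fps_zconst f * fps_zconst g.
Proof.
apply: fpsP => m; have [r ur dr] := monom_divisors m.
rewrite fps_zconstE !(fps_mul_divisors _ _ ur dr).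
rewrite laurentC_sum; apply: eq_bigr => a _; rewrite laurentC_sum.
by apply: eq_bigr => b _; rewrite !fps_zconstE laurentC_mul.
Qed.

Lemma fps_zpowD m n : fps_zpow (m + n) = fps_zpow m * fps_zpow n :> fps (laurent F) V.
Proof. by rewrite /fps_zpow zpowD fpsC_mul. Qed.

(** The inverse is a noncomputable choice, so it is identified by uniqueness: multiplicativity of
    [fps_zconst] provides an explicit inverse. *)
Lemma fps_zconstV f : f \is a GRing.unit ->
  (fps_zconst f)^-1 = fps_zconst f^-1.
Proof.
move=> fu; have ff : fps_zconst f * fps_zconst f^-1 = 1.
  by rewrite -fps_zconstM mulrV // fps_zconst1.
have zu : fps_zconst f \is a GRing.unit.
  by apply/unitrP; exists (fps_zconst f^-1); rewrite mulrC ff.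
by apply: (mulrI zu); rewrite mulrV.
Qed.

End Zconst.
End LaurentConstant.

(** * Renaming of variables along an injection *)

Section Rename.
Context {V W : choiceType} (i : V -> W).
Hypothesis inj_i : injective i.
Implicit Type m : monom V.

(** The map on monomials whose fibres index the sums in [fps_rename]. *)
Definition monom_rename (m : monom V) : monom W :=
  seq_mset [seq i v | v <- enum_mset m].

Lemma monom_renameE m v : monom_rename m (i v) = m v.
Proof.
rewrite mset_seqE count_map -count_mem_mset; apply: eq_count => x /=.
by rewrite (inj_eq inj_i).
Qed.

Lemma monom_rename_out m w : (forall v, i v <> w) -> monom_rename m w = 0%N.
Proof.
move=> iw; rewrite mset_seqE; apply/count_memPn/mapP => -[v _ wE].
exact: iw (esym wE).
Qed.

Lemma monom_rename_ext m (m' : monom W) : (forall v, m' (i v) = m v) ->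
  (forall w, (forall v, i v <> w) -> m' w = 0%N) -> m' = monom_rename m.
Proof.
move=> m'i m'out; apply/msetP => w.
have [[v <-]|iw] := pselect (exists v, i v = w); first by rewrite monom_renameE.
have iw' v : i v <> w by move=> vw; apply: iw; exists v.
by rewrite m'out // monom_rename_out.
Qed.

Lemma monom_rename_inj : injective monom_rename.
Proof.
by move=> m m' mm'; apply/msetP => v; rewrite -!monom_renameE mm'.
Qed.

Lemma monom_renameD m m' :
  monom_rename (m + m') = monom_rename m + monom_rename m'.
Proof.
apply/esym/monom_rename_ext => [v|w iw]; first by rewrite !msetE2 !monom_renameE.
by rewrite msetE2 !monom_rename_out.
Qed.

Lemma monom_rename0 : monom_rename 0 = 0.
Proof. by apply/esym/monom_rename_ext => [v|w _]; rewrite !fsfunE. Qed.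

Lemma monom_rename1 v : monom_rename [mset v]%mset = [mset i v]%mset.
Proof.
apply/esym/monom_rename_ext => [x|w iw]; rewrite !msetnE ?(inj_eq inj_i) //.
by case: eqP => // wE; case: (iw v).
Qed.

(** Exponents of a divisor are bounded by those of the multiple, so [a] involves only variables in
    the range of [i], and its exponents pull back along [i]. *)
Lemma monom_rename_divisor m (a b : monom W) : a + b = monom_rename m ->
  exists a', monom_rename a' = a.
Proof.
move=> abm; pose a' : monom V := [fsfun v in finsupp m => a (i v)].
have le_a w : (a w <= monom_rename m w)%N by rewrite -abm msetE2 leq_addr.
exists a'; apply/esym/monom_rename_ext => [v|w iw]; last first.
  by have := le_a w; rewrite (monom_rename_out m iw) leqn0 => /eqP.
(* Outside [finsupp m] the exponent of [a'] defaults to 0; this is correct since [a (i v)] is at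
   most [m v], which is 0 there. *)
rewrite fsfunE; case: ifPn => // /fsfun_dflt mv.
by have := le_a (i v); rewrite monom_renameE mv leqn0 => /eqP.
Qed.

Section Coefficients.
Context {R : comNzRingType}.
Implicit Types f g : fps R V.

(** Injectivity leaves [m] as the only monomial in the fibre, so the sum has one term. *)
Lemma fps_renameE f m : fps_rename i f (monom_rename m) = f m.
Proof.
rewrite /fps_rename /= -[RHS](fsbig_set1 +%R m (fcoef f)); apply: eq_fsbigl.
by apply/seteqP; split => x /=; [exact: monom_rename_inj|move->].
Qed.

Lemma fps_rename_out f (m : monom W) :
  (forall m', monom_rename m' <> m) -> fps_rename i f m = 0.
Proof. by move=> mi; rewrite /fps_rename /= fsbig1 // => m' /mi. Qed.

(** Splits an equality of series into monomials in the image of renaming and those outside; most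
    compatibility lemmas below follow this pattern. *)
Lemma fps_rename_ext (f : fps R V) (g : fps R W) :
  (forall m, g (monom_rename m) = f m) ->
  (forall m : monom W, (forall m', monom_rename m' <> m) -> g m = 0) ->
  fps_rename i f = g.
Proof.
move=> gf gout; apply: fpsP => m.
have [[m' <-]|mi] := pselect (exists m', monom_rename m' = m).
  by rewrite fps_renameE gf.
have mi' m' : monom_rename m' <> m by move=> E; apply: mi; exists m'.
by rewrite fps_rename_out // gout.
Qed.

Lemma fps_renameN f : fps_rename i (- f) = - fps_rename i f.
Proof.
apply: fps_rename_ext => m => [|mi]; rewrite fps_oppE.
  by rewrite fps_renameE.
by rewrite fps_rename_out // oppr0.
Qed.

(** Factorizations of a renamed monomial correspond bijectively to those of the original one, since
    its divisors are again renamed monomials. *)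
Lemma fps_renameM f g : fps_rename i (f * g) = fps_rename i f * fps_rename i g.
Proof.
apply: fps_rename_ext => m => [|mi].
  rewrite fps_mulE /conv (reindex_fsbig
    (fun p : monom V * monom V => (monom_rename p.1, monom_rename p.2))
    [set p | p.1 + p.2 = m]%classic).
    by apply: eq_fsbigr => p _; rewrite [(_, _).1]/= [(_, _).2]/= !fps_renameE.
  split=> [p /= <-|[a b] [c d] _ _ [/monom_rename_inj-> /monom_rename_inj->]//|].
    by rewrite monom_renameD.
  move=> [a b] /= abm; have [a' a'E] := monom_rename_divisor abm.
  have [b' b'E] := monom_rename_divisor (etrans (addrC _ _) abm).
  exists (a', b'); rewrite /= ?a'E ?b'E //; apply: monom_rename_inj.
  by rewrite monom_renameD a'E b'E.
(* A nonzero coefficient of the product would give two factors in the image of renaming, putting [m]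
   in that image too. *)
apply/eqP/negPn/negP => /conv_neq0[a [b [abm fa gb]]].
have ex (h : fps R V) c : fps_rename i h c != 0 -> exists c', monom_rename c' = c.
  move=> hc; apply/not_existsP => cE; case/eqP: hc; exact: fps_rename_out.
have [[a' a'E] [b' b'E]] := (ex _ _ fa, ex _ _ gb).
by apply: (mi (a' + b')); rewrite monom_renameD a'E b'E.
Qed.

Lemma monom_rename_eq0 m : (monom_rename m == 0) = (m == 0).
Proof. by rewrite -monom_rename0 (inj_eq monom_rename_inj). Qed.

Lemma fps_renameC (c : R) : fps_rename i (fpsC c) = fpsC c.
Proof.
apply: fps_rename_ext => m => [|mi] /=; first by rewrite monom_rename_eq0.
by case: eqP => // m0; case: (mi 0); rewrite monom_rename0.
Qed.

Lemma fps_renameX v : fps_rename i (fpsX v : fps R V) = fpsX (i v).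
Proof.
apply: fps_rename_ext => m => [|mi] /=.
  by rewrite -monom_rename1 (inj_eq monom_rename_inj).
by case: eqP => // m1; case: (mi [mset v]%mset); rewrite monom_rename1.
Qed.

Lemma fps_rename1 : fps_rename i (1 : fps R V) = 1.
Proof. by rewrite -!fpsC1 fps_renameC. Qed.

Lemma fps_renameXn f n : fps_rename i (f ^+ n) = fps_rename i f ^+ n.
Proof. by elim: n => [|n IHn]; rewrite ?fps_rename1 // !exprS fps_renameM IHn. Qed.

End Coefficients.

(** The sums over [n] agree term by term, because renaming commutes with powers. *)
Lemma fps_rename_exp {F : comUnitRingType} (f : fps F V) :
  fps_rename i (fps_exp f) = fps_exp (fps_rename i f).
Proof.
apply: fps_rename_ext => m => [|mi].
  by apply: eq_fsbigr => n _; rewrite -fps_renameXn fps_renameE.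
by apply: fsbig1 => n _; rewrite -fps_renameXn fps_rename_out // mul0r.
Qed.

Lemma fps_rename_zpow {F : comUnitRingType} n :
  fps_rename i (fps_zpow n : fps (laurent F) V) = fps_zpow n.
Proof. exact: fps_renameC. Qed.

Lemma fps_rename_xi {F : comUnitRingType} (x : nat -> fps (laurent F) V) :
  fps_rename i (xi x) = xi (fun k => fps_rename i (x k)).
Proof.
have zx k : fps_zpow k.+1%:Z * fps_rename i (x k) =
            fps_rename i (fps_zpow k.+1%:Z * x k).
  by rewrite fps_renameM fps_rename_zpow.
apply: fps_rename_ext => m => [|mi].
  by apply: eq_fsbigr => k _; rewrite zx fps_renameE.
by apply: fsbig1 => k _; rewrite zx fps_rename_out.
Qed.

Lemma fps_rename_zconst {F : comUnitRingType} (f : fps F V) :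
  fps_rename i (fps_zconst f) = fps_zconst (fps_rename i f).
Proof.
by apply: fps_rename_ext => m => [|mi]; rewrite !fps_zconstE
  ?fps_renameE // fps_rename_out // laurentC0.
Qed.

End Rename.

(** * The residue [oint] and factors free of [z] *)

Section Oint.
Context {R : realType} {V : choiceType}.
Implicit Types (f : fps R[i] V) (g : fps (laurent R[i]) V).

Lemma ointE g m : oint g m = (2 * trigo.pi)%:C%C * 'i%C * g m (-1).
Proof. by []. Qed.

(** Multiplication by a series free of [z] acts on each power of [z] separately, so it commutes with
    taking the coefficient of [z^-1]. *)
Lemma oint_zconstM f g : oint (fps_zconst f * g) = f * oint g.
Proof.
apply: fpsP => m; have [r ur dr] := monom_divisors m.
rewrite ointE !(fps_mul_divisors _ _ ur dr).
rewrite laurent_sumE mulr_sumr; apply: eq_bigr => x _.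
rewrite laurent_sumE mulr_sumr; apply: eq_bigr => y _.
by rewrite fps_zconstE laurentCM ointE mulrCA.
Qed.

Lemma ointN g : oint (- g) = - oint g.
Proof. by apply: fpsP => m; rewrite ointE fps_oppE mulrN. Qed.

End Oint.

(** * Orders of power series by total degree *)

Section Degree.
Context {R : comNzRingType} {V : choiceType}.
Implicit Types (f g : fps R V) (m : monom V).

Lemma size_monomD m m' :
  size (enum_mset (m + m')) = (size (enum_mset m) + size (enum_mset m'))%N.
Proof.
rewrite -size_cat; apply: perm_size; apply/allP => v _ /=.
by rewrite count_cat !count_mem_mset msetE2.
Qed.

Lemma size_monom_gt0 m : m != 0 -> (0 < size (enum_mset m))%N.
Proof. by rewrite lt0n size_mset_eq0. Qed.

(** The filtration by total degree, the degree of a monomial being its size as a multiset. *)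
Definition order_ge n f := forall m, (size (enum_mset m) < n)%N -> f m = 0.

Lemma order_geM n p f g : order_ge n f -> order_ge p g -> order_ge (n + p) (f * g).
Proof.
move=> fn gp m mnp; apply/eqP/negPn/negP; rewrite fps_mulE.
move=> /conv_neq0[a [b [abm fa gb]]]; move: mnp; rewrite -abm size_monomD.
apply/negP; rewrite -leqNgt leq_add // leqNgt.
  by apply: contraNN fa => /fn ->.
by apply: contraNN gb => /gp ->.
Qed.

(** A series without constant term has order at least 1, and orders add; this makes each coefficient
    of [fps_exp] a finite sum. *)
Lemma order_geX f n : f 0 = 0 -> order_ge n (f ^+ n).
Proof.
move=> f0; elim: n => [//|n IHn]; rewrite exprS -add1n; apply: order_geM IHn.
move=> m m1; have [-> //|/size_monom_gt0] := eqVneq m 0.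
by move: m1; case: size.
Qed.

End Degree.

(** Both sides run over the pairs with [i + j <= D], grouped on the left by the value of [i + j]. *)
Lemma sum_triangle (A : nmodType) D (G : nat -> nat -> A) :
  \sum_(n < D.+1) \sum_(k < n.+1) G (n - k)%N k =
  \sum_(i < D.+1) \sum_(j < D.+1 | (i + j <= D)%N) G i j.
Proof.
transitivity (\sum_(n < D.+1) \sum_(p : 'I_D.+1 * 'I_D.+1 | (p.1 + p.2 == n)%N)
  G p.1 p.2).
  (* A pair with sum [n] is determined by its second entry [k]; [inord] keeps the values because [k]
     and [n - k] are at most [D]. *)
  apply: eq_bigr => n _; rewrite (reindex_onto
    (fun k : 'I_n.+1 => (inord (n - k), inord k) : 'I_D.+1 * 'I_D.+1)
    (fun p => inord p.2)) /=; last first.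
    move=> [i j] /= /eqP ijn; have [iD jD] := (ltn_ord i, ltn_ord j).
    by congr (_, _); apply: val_inj; rewrite /= ?inordK //; lia.
  symmetry; rewrite (eq_bigl xpredT).
    apply: eq_bigr => k _; have [kn nD] := (ltn_ord k, ltn_ord n).
    by rewrite !inordK //; lia.
  move=> k; have [kn nD] := (ltn_ord k, ltn_ord n).
  rewrite !inordK ?inord_val ?eqxx ?andbT; [by apply/eqP; lia|lia|lia].
rewrite (exchange_big_dep (fun p : 'I_D.+1 * 'I_D.+1 => p.1 + p.2 <= D)%N) /=.
  rewrite [RHS]pair_big_dep /=; apply: eq_bigr => -[i j] /= ijD.
  by rewrite (big_pred1 (inord (i + j))) // => n /=; rewrite -[RHS]val_eqE /= inordK // eq_sym.
by move=> n [i j] _ /= /eqP ->; rewrite -ltnS.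
Qed.

(** * Exponentials of sums *)

Section Exp.
Context {F : comUnitRingType} {V : choiceType}.
Hypothesis natF_unit : forall n, n.+1%:R \is a @GRing.unit F.
Implicit Types (f g : fps F V) (m : monom V).

Let fact_unit n : n`!%:R \is a @GRing.unit F.
Proof. by case: n`! (fact_gt0 n) => // k _. Qed.

Let c n : fps F V := fpsC n`!%:R^-1.

(** The factorial formula for binomial coefficients, which turns the binomial expansion into a
    product of two exponential sums. *)
Let c_bin n k : (k <= n)%N -> c n *+ 'C(n, k) = c (n - k) * c k.
Proof.
move=> kn; rewrite -fpsC_mul -fpsCMn; congr fpsC; apply: (mulrI (fact_unit n)).
rewrite mulrnAr divrr // -(bin_fact kn) !natrM -!mulrA -[LHS]mulr1.
by congr (_ * _); rewrite (mulrA _ _ k`!%:R^-1) divrr // mul1r divrr.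
Qed.

(** Powers of [f] beyond [D] have order above the degree of [m], so they do not contribute. *)
Lemma fps_expE f m D : f 0 = 0 -> (size (enum_mset m) <= D)%N ->
  fps_exp f m = (\sum_(n < D.+1) c n * f ^+ n) m.
Proof.
move=> f0 mD; rewrite fps_sumE /=.
rewrite -(big_mkord xpredT (fun n => (c n * f ^+ n) m)).
have -> : [set: nat]%classic = [set` xpredT]%classic.
  by apply/seteqP; split.
rewrite -(@bigfs _ _ _ _ (index_iota 0 D.+1)) ?iota_uniq //.
  by apply: eq_bigr => n _; rewrite fpsCM mulrC.
move=> n _; rewrite mem_index_iota /= -leqNgt => Dn.
by rewrite (order_geX f0) ?mul0r // (leq_ltn_trans mD).
Qed.

(** At a monomial of degree [D] all exponentials are cut at [D]. The binomial formula then gives the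
    terms with [i + j <= D], and the remaining terms of the product have order above [D], so they
    vanish at [m]. *)
Lemma fps_expD f g : f 0 = 0 -> g 0 = 0 ->
  fps_exp (f + g) = fps_exp f * fps_exp g.
Proof.
move=> f0 g0; apply: fpsP => m; pose D := size (enum_mset m).
have fg0 : (f + g) 0 = 0 by rewrite fps_addE f0 g0 addr0.
rewrite (fps_expE fg0 (leqnn D)).
(* Divisors of [m] have degree at most [D], so both factors may be truncated at [D] too. *)
rewrite (@eq_conv _ _ _ (\sum_(n < D.+1) c n * f ^+ n) _
                        (\sum_(n < D.+1) c n * g ^+ n)); last first.
  move=> a b abm; split; apply: fps_expE => //;
    by rewrite /D -abm size_monomD ?leq_addr ?leq_addl.
pose G i j := c i * f ^+ i * (c j * g ^+ j).
have E : \sum_(n < D.+1) c n * (f + g) ^+ n =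
         \sum_(n < D.+1) \sum_(k < n.+1) G (n - k)%N k.
  apply: eq_bigr => n _; rewrite exprDn mulr_sumr; apply: eq_bigr => k _.
  by rewrite /G mulrACA -c_bin -1?ltnS // mulrnAr mulrnAl.
rewrite E sum_triangle mulr_suml !fps_sumE; apply: eq_bigr => i _.
rewrite mulr_sumr !fps_sumE big_mkcond; apply: eq_bigr => j _.
case: leqP => // Dij.
have Gc : G i j = c i * (c j * (f ^+ i * g ^+ j)) by rewrite /G mulrACA -mulrA.
suff: G i j m = 0 by move=> ->.
by rewrite Gc fpsCM fpsCM (order_geM (order_geX f0) (order_geX g0) Dij) !mulr0.
Qed.

End Exp.

(** * The series [xi] and its exponential *)

Section Xi.
Context {F : comUnitRingType} {V : choiceType}.

Lemma fps_zpowM n (f : fps (laurent F) V) m : (fps_zpow n * f) m = zpow n * f m.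
Proof. exact: fpsCM. Qed.

Lemma xiE (x : nat -> fps (laurent F) V) m :
  xi x m = \sum_(k \in [set: nat]%classic) (fps_zpow k.+1%:Z * x k) m.
Proof. by []. Qed.

Lemma xi0 (x : nat -> fps (laurent F) V) : (forall k, x k 0 = 0) -> xi x 0 = 0.
Proof. by move=> x0; rewrite xiE fsbig1 // => k _; rewrite fps_zpowM x0 mulr0. Qed.

(** The sum in [xi] takes the default value 0 on an infinite support; the bound [K] reduces each
    coefficient to a finite sum, where subtraction is termwise. *)
Lemma xiB (x y : nat -> fps (laurent F) V) :
  (forall m, exists K, forall k, (K <= k)%N -> x k m = 0 /\ y k m = 0) ->
  xi (fun k => x k - y k) = xi x - xi y.
Proof.
move=> bnd; apply: fpsP => m; have [K xyK] := bnd m.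
have xi_trunc (z : nat -> fps (laurent F) V) : (forall k, (K <= k)%N -> z k m = 0) ->
    xi z m = \sum_(k <- iota 0 K) (fps_zpow k.+1%:Z * z k) m.
  move=> zK; rewrite xiE.
  have -> : [set: nat]%classic = [set` xpredT]%classic by apply/seteqP.
  symmetry; apply: bigfs; rewrite ?iota_uniq // => k _.
  by rewrite mem_iota add0n leq0n -leqNgt => Kk; rewrite fps_zpowM zK ?mulr0.
rewrite fps_addE fps_oppE !xi_trunc => [|k /xyK[]//|k /xyK[]//|k /xyK[xk yk]].
  rewrite -sumrB; apply: eq_bigr => k _.
  by rewrite mulrBr fps_addE fps_oppE.
by rewrite fps_addE fps_oppE xk yk subr0.
Qed.

(** An injective enumeration meets a given monomial at most once, so [K] is one past that index, or
    0 if there is none. *)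
Lemma fpsX_bound (v : nat -> V) : injective v -> forall m, exists K,
  forall k, (K <= k)%N -> (fpsX (v k) : fps (laurent F) V) m = 0.
Proof.
move=> inj_v m; have [[k0 ->]|mv] := pselect (exists k, m = [mset v k]%mset).
  exists k0.+1 => k kk0 /=; case: eqP => // /msetP/(_ (v k0)).
  by rewrite !msetnE eqxx; case: eqP => // /inj_v E; move: kk0; rewrite E ltnn.
by exists 0%N => k _ /=; case: eqP => // mvk; case: mv; exists k.
Qed.

Lemma fpsX0 (v : V) : (fpsX v : fps (laurent F) V) 0 = 0.
Proof.
by rewrite /=; case: eqP => // /msetP/(_ v); rewrite msetnxx fsfunE.
Qed.

End Xi.

(** Stated for an arbitrary injective family of variables so that it serves the times [t] and
    [\bar t] alike. *)
Lemma fps_exp_xi_diff {R : realType} {V : choiceType} (v : nat -> V) :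
  injective v ->
  let X k : fps (laurent R[i]) V := fpsX (v k) in
  fps_exp (xi (fun k => fps_rename inl (X k) - fps_rename inr (X k))) =
  fps_rename inl (fps_exp (xi X)) * fps_rename inr (fps_exp (- xi X))
  :> fps (laurent R[i]) (V + V)%type.
Proof.
move=> inj_v X.
have inl_inj : injective (@inl V V) by move=> x y [].
have inr_inj : injective (@inr V V) by move=> x y [].
have natF_unit n : n.+1%:R \is a @GRing.unit (laurent R[i]).
  by rewrite -laurentC_nat laurentC_unit // unitfE pnatr_eq0.
rewrite !fps_rename_exp // fps_renameN // !fps_rename_xi //.
rewrite xiB => [|m]; last first.
  have [|K XK] := @fpsX_bound R[i] _ (inl \o v) _ m; first exact: inj_comp.
  have [|K' XK'] := @fpsX_bound R[i] _ (inr \o v) _ m; first exact: inj_comp.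
  exists (maxn K K') => k; rewrite geq_max !fps_renameX // => /andP[Kk K'k].
  by split; [exact: XK|exact: XK'].
have X0 (w : V -> V + V) k : injective w -> fps_rename w (X k) 0 = 0.
  by move=> inj_w; rewrite fps_renameX // fpsX0.
rewrite fps_expD // ?fps_oppE ?xi0 ?oppr0 // => k; exact: X0.
Qed.

(** Rearranges one summand: [p], [q] stand for powers of [z], [e], [e'] for exponentials, [f], [g]
    for shifted taus, [u], [v] for inverse denominators and [x] for the sign. *)
Lemma wave_product (A : comNzRingType) (p q e e' f g u v x : A) :
  p * e * f * u * - (x * q * e' * g * v) =
  - (u * v * (x * (p * q * (e * e') * f * g))).
Proof. by ring. Qed.

(** Here the sign sits on the first factor, and [r] stands for [z^-2]. *)
Lemma wave_bar_product (A : comNzRingType) (p q r e e' f g u v x : A) :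
  - (x * p * e * f * u) * (q * e' * g * v) * r =
  - (u * v * (x * (p * q * r * (e * e') * f * g))).
Proof. by ring. Qed.

(** * Clearing denominators in the bilinear identity *)

Section TauBilinear.
Context {R : realType} {N : nat} (tau : tau_family R N) (tau0 : lattice N -> @series R N).
Hypothesis tau0_unit : forall s, tau0 s \is a GRing.unit.
Implicit Types (s : lattice N) (a b c : 'I_N).

Let inl_inj : injective (@inl (times N) (times N)). Proof. by move=> x y []. Qed.
Let inr_inj : injective (@inr (times N) (times N)). Proof. by move=> x y []. Qed.

Lemma exp_tdiff c : fps_exp (xi (tdiff c)) =
  unprimed (fps_exp (xi (tvar c))) * primed (fps_exp (- xi (tvar c)))
  :> @zseries2 R N.
Proof. by apply: fps_exp_xi_diff => k k' []. Qed.

Lemma exp_tbdiff c : fps_exp (xi (tbdiff c)) =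
  unprimed (fps_exp (xi (tbvar c))) * primed (fps_exp (- xi (tbvar c)))
  :> @zseries2 R N.
Proof. by apply: fps_exp_xi_diff => k k' []. Qed.

(** The exponent on the left is 0 or -1, and [-1] is its own inverse. *)
Lemma sign_kdelta {A : comUnitRingType} a b :
  (-1) ^ (kdelta a b - 1) = - (-1) ^ kdelta a b :> A.
Proof.
rewrite /kdelta; case: (a == b); first by rewrite subrr expr0z expr1z opprK.
by rewrite sub0r expr0z exprN1 invrN1.
Qed.

Lemma kdeltaC a b : kdelta a b = kdelta b a :> int.
Proof. by rewrite /kdelta eq_sym. Qed.

Lemma oint_sign a b (f : @zseries2 R N) :
  oint ((-1) ^ kdelta a b * f) = (-1) ^ kdelta a b * oint f.
Proof.
rewrite /kdelta; case: (a == b); last by rewrite !expr0z !mul1r.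
by rewrite !expr1z !mulN1r ointN.
Qed.

Lemma unprimed_sign a b : unprimed ((-1) ^ kdelta a b) = (-1) ^ kdelta a b :> @zseries2 R N.
Proof.
rewrite /kdelta; case: (a == b); rewrite ?expr0z ?expr1z /unprimed.
  by rewrite fps_renameN // fps_rename1.
exact: fps_rename1.
Qed.

Lemma primed_sign a b : primed ((-1) ^ kdelta a b) = (-1) ^ kdelta a b :> @zseries2 R N.
Proof.
rewrite /kdelta; case: (a == b); rewrite ?expr0z ?expr1z /primed.
  by rewrite fps_renameN // fps_rename1.
exact: fps_rename1.
Qed.

(** The inverse of the common denominator, free of [z] so that it can stand outside [oint]. *)
Definition inv_tau s s' : fps R[i] (times N + times N)%type :=
  fps_rename inl (tau0 s)^-1 * fps_rename inr (tau0 s')^-1.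

Lemma inv_tau_unit s s' : inv_tau s s' \is a GRing.unit.
Proof.
apply/unitrP; exists (fps_rename inl (tau0 s) * fps_rename inr (tau0 s')).
have E : fps_rename inl (tau0 s) * fps_rename inr (tau0 s') * inv_tau s s' = 1.
  by rewrite mulrACA -!fps_renameM // !mulrV // !fps_rename1 // mulr1.
by rewrite E mulrC E.
Qed.

(** This and the next three lemmas bring the wave functions to the doubled variables, in the shape
    expected by [wave_product] and [wave_bar_product]. *)
Lemma unprimed_tau_Psi a c s : unprimed (tau_Psi tau tau0 s a c) =
  fps_zpow (s 0 c + kdelta a c - 1) * unprimed (fps_exp (xi (tvar c)))
  * unprimed (tshift false c (-1) (tau a c s))
  * fps_zconst (fps_rename inl (tau0 s)^-1).
Proof.
(* Renaming is pulled out of every factor on the right, which leaves an equality of series before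
   renaming. *)
rewrite -(fps_rename_zconst inl_inj) -(fps_rename_zpow inl_inj) /unprimed.
by rewrite -3!(fps_renameM inl_inj) /tau_Psi fps_zconstV.
Qed.

Lemma primed_tau_Psis c b s : primed (tau_Psis tau tau0 s c b) =
  - ((-1) ^ kdelta c b * fps_zpow (- s 0 c + kdelta c b - 1)
     * primed (fps_exp (- xi (tvar c)))
     * primed (tshift false c 1 (tau c b s))
     * fps_zconst (fps_rename inr (tau0 s)^-1)).
Proof.
rewrite -(fps_rename_zconst inr_inj) -(fps_rename_zpow inr_inj).
rewrite -primed_sign /primed -4!(fps_renameM inr_inj) -(fps_renameN inr_inj).
by rewrite /tau_Psis fps_zconstV // sign_kdelta !mulNr.
Qed.

Lemma unprimed_tau_Psib a c s : unprimed (tau_Psib tau tau0 s a c) =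
  - ((-1) ^ kdelta a c * fps_zpow (- s 0 c)
     * unprimed (fps_exp (xi (tbvar c)))
     * unprimed (tshift true c (-1) (tau a c (s + unitv c)))
     * fps_zconst (fps_rename inl (tau0 s)^-1)).
Proof.
rewrite -(fps_rename_zconst inl_inj) -(fps_rename_zpow inl_inj).
rewrite -unprimed_sign /unprimed -4!(fps_renameM inl_inj) -(fps_renameN inl_inj).
by rewrite /tau_Psib fps_zconstV // sign_kdelta !mulNr.
Qed.

Lemma primed_tau_Psibs c b s : primed (tau_Psibs tau tau0 s c b) =
  fps_zpow (s 0 c) * primed (fps_exp (- xi (tbvar c)))
  * primed (tshift true c 1 (tau c b (s - unitv c)))
  * fps_zconst (fps_rename inr (tau0 s)^-1).
Proof.
rewrite -(fps_rename_zconst inr_inj) -(fps_rename_zpow inr_inj) /primed.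
by rewrite -3!(fps_renameM inr_inj) /tau_Psibs fps_zconstV.
Qed.

Lemma oint_tau_Psi a b c s s' :
  oint (unprimed (tau_Psi tau tau0 s a c) * primed (tau_Psis tau tau0 s' c b)) =
  - inv_tau s s' * ((-1) ^ kdelta b c *
    oint (fps_zpow (s 0 c - s' 0 c + kdelta a c + kdelta b c - 2)
          * fps_exp (xi (tdiff c))
          * unprimed (tshift false c (-1) (tau a c s))
          * primed (tshift false c 1 (tau c b s')))).
Proof.
rewrite -oint_sign mulNr -oint_zconstM -ointN; congr oint.
(* The exponent splits into those of [tau_Psi] and [tau_Psis], each carrying one [-1]. *)
have -> : s 0 c - s' 0 c + kdelta a c + kdelta b c - 2 =
  (s 0 c + kdelta a c - 1) + (- s' 0 c + kdelta c b - 1).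
  by rewrite (kdeltaC b c); ring.
rewrite fps_zpowD unprimed_tau_Psi primed_tau_Psis exp_tdiff fps_zconstM.
rewrite (kdeltaC b c).
exact: wave_product.
Qed.

(** The factor [- inv_tau s s'] is the one found on the unbarred side and is independent of [c], so
    it cancels between the two sums. *)
Lemma oint_tau_Psib a b c s s' :
  oint (unprimed (tau_Psib tau tau0 s a c) * primed (tau_Psibs tau tau0 s' c b)
        * fps_zpow (- 2)) =
  - inv_tau s s' * ((-1) ^ kdelta a c *
    oint (fps_zpow (s' 0 c - s 0 c - 2)
          * fps_exp (xi (tbdiff c))
          * unprimed (tshift true c (-1) (tau a c (s + unitv c)))
          * primed (tshift true c 1 (tau c b (s' - unitv c))))).
Proof.
rewrite -oint_sign mulNr -oint_zconstM -ointN; congr oint.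
have -> : s' 0 c - s 0 c - 2 = - s 0 c + s' 0 c + -2 by ring.
rewrite 2!fps_zpowD unprimed_tau_Psib primed_tau_Psibs exp_tbdiff fps_zconstM.
exact: wave_bar_product.
Qed.

End TauBilinear.

Lemma eq_sum_mull (A : unitRingType) (I : finType) (u : A) (f g f' g' : I -> A) :
  u \is a GRing.unit ->
  (forall c, f c = u * f' c) -> (forall c, g c = u * g' c) ->
  \sum_c f c = \sum_c g c -> \sum_c f' c = \sum_c g' c.
Proof.
move=> unit_u ff' gg' fg; apply: (mulrI unit_u); rewrite !mulr_sumr.
by rewrite -(eq_bigr _ (fun c _ => ff' c)) -(eq_bigr _ (fun c _ => gg' c)).
Qed.

Theorem theorem5p2 (R : realType) (N : nat) (hN : (0 < N)%N)
    (tau : tau_family R N) (htau : tau_function tau)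
    (a b : 'I_N) (s s' : lattice N) :
  \sum_(c < N) (-1) ^ kdelta b c *
    oint (fps_zpow (s 0 c - s' 0 c + kdelta a c + kdelta b c - 2)
          * fps_exp (xi (tdiff c))
          * unprimed (tshift false c (-1) (tau a c s))
          * primed (tshift false c 1 (tau c b s'))) =
  \sum_(c < N) (-1) ^ kdelta a c *
    oint (fps_zpow (s' 0 c - s 0 c - 2)
          * fps_exp (xi (tbdiff c))
          * unprimed (tshift true c (-1) (tau a c (s + unitv c)))
          * primed (tshift true c 1 (tau c b (s' - unitv c)))).
Proof.
have [tau0 [_ tau0_unit [_ _ _ _ bilinear]]] := htau.
have unit_u : - inv_tau tau0 s s' \is a GRing.unit by rewrite unitrN inv_tau_unit.
exact: (eq_sum_mull unit_u (fun c => oint_tau_Psi tau tau0_unit a b c s s')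
  (fun c => oint_tau_Psib tau tau0_unit a b c s s') (bilinear s s' a b)).
Qed.
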